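(* Let $K=\mathbb{Q}(d_1,\dots,d_6)$ with $d_1,\dots,d_6$ indeterminates. Consider the cubic surface in $\mathbb{P}^3_K$ that is the closure of the image of the rational map $\mathbb{P}^2\dashrightarrow\mathbb{P}^3$ given by the ternary cubics $$x=F_{12}F_{34}F_{56},\quad y=F_{13}F_{25}F_{46},\quad z=F_{12}F_{35}F_{46},\quad w=F_{13}F_{24}F_{56}.$$ This surface is defined by the octanomial $$a\,xyz+b\,xyw+c\,xzw+d\,yzw+e\,x^2y+f\,xy^2+g\,z^2w+h\,zw^2$$ whose eight coefficients are $$\begin{aligned} a={}& d_1d_3d_2d_4(d_1+d_3-d_2-d_4)+d_2d_4d_5d_6(d_2+d_4-d_5-d_6)+d_5d_6d_1d_3(d_5+d_6-d_1-d_3)\\ &+d_5d_6(d_5+d_6)(d_1^2+d_3^2-d_2^2-d_4^2)+d_1d_3(d_1+d_3)(d_2^2+d_4^2-d_5^2-d_6^2)+d_2d_4(d_2+d_4)(d_5^2+d_6^2-d_1^2-d_3^2),\\ b={}& d_1d_2d_3d_5(d_1+d_2-d_3-d_5)+d_3d_5d_4d_6(d_3+d_5-d_4-d_6)+d_4d_6d_1d_2(d_4+d_6-d_1-d_2)\\ &+d_4d_6(d_4+d_6)(d_1^2+d_2^2-d_3^2-d_5^2)+d_1d_2(d_1+d_2)(d_3^2+d_5^2-d_4^2-d_6^2)+d_3d_5(d_3+d_5)(d_4^2+d_6^2-d_1^2-d_2^2),\\ c={}& d_1d_3d_2d_5(d_1+d_3-d_2-d_5)+d_2d_5d_4d_6(d_2+d_5-d_4-d_6)+d_4d_6d_1d_3(d_4+d_6-d_1-d_3)\\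 &+d_4d_6(d_4+d_6)(d_1^2+d_3^2-d_2^2-d_5^2)+d_1d_3(d_1+d_3)(d_2^2+d_5^2-d_4^2-d_6^2)+d_2d_5(d_2+d_5)(d_4^2+d_6^2-d_1^2-d_3^2),\\ d={}& d_1d_2d_3d_4(d_1+d_2-d_3-d_4)+d_3d_4d_5d_6(d_3+d_4-d_5-d_6)+d_5d_6d_1d_2(d_5+d_6-d_1-d_2)\\ &+d_5d_6(d_5+d_6)(d_1^2+d_2^2-d_3^2-d_4^2)+d_1d_2(d_1+d_2)(d_3^2+d_4^2-d_5^2-d_6^2)+d_3d_4(d_3+d_4)(d_5^2+d_6^2-d_1^2-d_2^2),\\ e={}&-(d_1+d_3+d_5)(d_2+d_4+d_6)(d_1-d_5)(d_2-d_6)(d_3-d_4),\\ f={}&-(d_1+d_2+d_4)(d_3+d_5+d_6)(d_1-d_4)(d_2-d_5)(d_3-d_6),\\ g={}&-(d_1+d_3+d_4)(d_2+d_5+d_6)(d_1-d_4)(d_2-d_6)(d_3-d_5),\\ h={}&-(d_1+d_2+d_5)(d_3+d_4+d_6)(d_1-d_5)(d_3-d_6)(d_2-d_4). \end{aligned}$$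
   Context: Homogeneous coordinates on $\mathbb{P}^2$ and $\mathbb{P}^3$ are $(X:Y:Z)$ and $(x:y:z:w)$. The six points in $\mathbb{P}^2$ are $(1:d_i:d_i^3)$, $i=1,\dots,6$, and for $1\le i<j\le 6$ $$F_{ij}=d_id_j(d_i+d_j)\cdot X-(d_i^2+d_id_j+d_j^2)\cdot Y+Z$$ is a linear form vanishing on the $i$-th and $j$-th points. The four cubics above form a basis of the space of ternary cubics vanishing at the six points. *)

(* Defs.v *)
From HB Require Import structures.
From mathcomp Require Import all_boot all_order all_algebra.
From mathcomp Require Import mpoly.

Set Implicit Arguments.
Unset Strict Implicit.
Unset Printing Implicit Defensive.

Import GRing.Theory.
Local Open Scope ring_scope.

(* Projective geometry over a field k, through the points with coordinates in
   an extension L of k, given by iota.  A point of P^(n-1)(L) is represented by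
   its homogeneous coordinate vectors, that is, by nonzero row vectors; a set of
   points is a predicate on vectors.  The Zariski topology is that of the scheme
   P^(n-1)_k: closed sets are cut out by forms with coefficients in k. *)

Definition vanishes_at (k L : fieldType) (iota : {rmorphism k -> L}) (n : nat)
    (G : {mpoly k[n]}) (q : 'rV[L]_n) : Prop :=
  (map_mpoly iota G).@[q 0] = 0.

Definition proj_zeros (k L : fieldType) (iota : {rmorphism k -> L}) (n : nat)
    (G : {mpoly k[n]}) (q : 'rV[L]_n) : Prop :=
  q != 0 /\ vanishes_at iota G q.

Definition zariski_closure (k L : fieldType) (iota : {rmorphism k -> L})
    (n : nat) (S : 'rV[L]_n -> Prop) (q : 'rV[L]_n) : Prop :=
  q != 0 /\
  forall (m : nat) (G : {mpoly k[n]}), G \is m.-homog ->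
    (forall p, S p -> vanishes_at iota G p) -> vanishes_at iota G q.

Definition eval_forms (k L : fieldType) (iota : {rmorphism k -> L})
    (m n : nat) (phi : n.-tuple {mpoly k[m]}) (P : 'rV[L]_m) : 'rV[L]_n :=
  \row_i (map_mpoly iota (tnth phi i)).@[P 0].

(* Image of P^(m-1) --> P^(n-1), P |-> (phi_1(P) : ... : phi_n(P)), for forms
   phi_i of the same degree: the map is defined at P when the phi_i(P) are not
   all 0, and the scalar c ranges over all coordinate vectors of the value. *)
Definition rational_image (k L : fieldType) (iota : {rmorphism k -> L})
    (m n : nat) (phi : n.-tuple {mpoly k[m]}) (q : 'rV[L]_n) : Prop :=
  exists (P : 'rV[L]_m) (c : L),
    [/\ P != 0, eval_forms iota phi P != 0, c != 0
      & q = c *: eval_forms iota phi P].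

(* S is the hypersurface of degree r with equation f = 0: it is the zero locus
   of f, and the homogeneous ideal of S is generated by f (so that, for
   instance, f may not be replaced by its square). *)
Definition hypersurface_defined_by (k L : fieldType)
    (iota : {rmorphism k -> L}) (n r : nat) (S : 'rV[L]_n -> Prop)
    (f : {mpoly k[n]}) : Prop :=
  [/\ f != 0, f \is r.-homog,
      (forall q, S q <-> proj_zeros iota f q)
    & forall (m : nat) (G : {mpoly k[n]}), G \is m.-homog ->
        ((forall q, S q -> vanishes_at iota G q) <->
         exists H : {mpoly k[n]}, G = H * f)].

Definition K : fieldType := {fraction {mpoly rat[6]}}.

(* The indeterminates are numbered from 1 to 6, the variables of
   {mpoly rat[6]} from 0 to 5. *)
Definition d_ (i : nat) : K := @tofrac {mpoly rat[6]} 'X_(inord i.-1).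

Local Notation d1 := (d_ 1).
Local Notation d2 := (d_ 2).
Local Notation d3 := (d_ 3).
Local Notation d4 := (d_ 4).
Local Notation d5 := (d_ 5).
Local Notation d6 := (d_ 6).

Definition F (i j : nat) : {mpoly K[3]} :=
  let X := 'X_0 in let Y := 'X_1 in let Z := 'X_2 in
  (d_ i * d_ j * (d_ i + d_ j)) *: X
  - (d_ i ^+ 2 + d_ i * d_ j + d_ j ^+ 2) *: Y + Z.

Definition cubics : 4.-tuple {mpoly K[3]} :=
  [tuple F 1 2 * F 3 4 * F 5 6; F 1 3 * F 2 5 * F 4 6;
         F 1 2 * F 3 5 * F 4 6; F 1 3 * F 2 4 * F 5 6].

Definition coef_a : K :=
  d1 * d3 * d2 * d4 * (d1 + d3 - d2 - d4)
  + d2 * d4 * d5 * d6 * (d2 + d4 - d5 - d6)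
  + d5 * d6 * d1 * d3 * (d5 + d6 - d1 - d3)
  + d5 * d6 * (d5 + d6) * (d1 ^+ 2 + d3 ^+ 2 - d2 ^+ 2 - d4 ^+ 2)
  + d1 * d3 * (d1 + d3) * (d2 ^+ 2 + d4 ^+ 2 - d5 ^+ 2 - d6 ^+ 2)
  + d2 * d4 * (d2 + d4) * (d5 ^+ 2 + d6 ^+ 2 - d1 ^+ 2 - d3 ^+ 2).

Definition coef_b : K :=
  d1 * d2 * d3 * d5 * (d1 + d2 - d3 - d5)
  + d3 * d5 * d4 * d6 * (d3 + d5 - d4 - d6)
  + d4 * d6 * d1 * d2 * (d4 + d6 - d1 - d2)
  + d4 * d6 * (d4 + d6) * (d1 ^+ 2 + d2 ^+ 2 - d3 ^+ 2 - d5 ^+ 2)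
  + d1 * d2 * (d1 + d2) * (d3 ^+ 2 + d5 ^+ 2 - d4 ^+ 2 - d6 ^+ 2)
  + d3 * d5 * (d3 + d5) * (d4 ^+ 2 + d6 ^+ 2 - d1 ^+ 2 - d2 ^+ 2).

Definition coef_c : K :=
  d1 * d3 * d2 * d5 * (d1 + d3 - d2 - d5)
  + d2 * d5 * d4 * d6 * (d2 + d5 - d4 - d6)
  + d4 * d6 * d1 * d3 * (d4 + d6 - d1 - d3)
  + d4 * d6 * (d4 + d6) * (d1 ^+ 2 + d3 ^+ 2 - d2 ^+ 2 - d5 ^+ 2)
  + d1 * d3 * (d1 + d3) * (d2 ^+ 2 + d5 ^+ 2 - d4 ^+ 2 - d6 ^+ 2)
  + d2 * d5 * (d2 + d5) * (d4 ^+ 2 + d6 ^+ 2 - d1 ^+ 2 - d3 ^+ 2).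

Definition coef_d : K :=
  d1 * d2 * d3 * d4 * (d1 + d2 - d3 - d4)
  + d3 * d4 * d5 * d6 * (d3 + d4 - d5 - d6)
  + d5 * d6 * d1 * d2 * (d5 + d6 - d1 - d2)
  + d5 * d6 * (d5 + d6) * (d1 ^+ 2 + d2 ^+ 2 - d3 ^+ 2 - d4 ^+ 2)
  + d1 * d2 * (d1 + d2) * (d3 ^+ 2 + d4 ^+ 2 - d5 ^+ 2 - d6 ^+ 2)
  + d3 * d4 * (d3 + d4) * (d5 ^+ 2 + d6 ^+ 2 - d1 ^+ 2 - d2 ^+ 2).

Definition coef_e : K :=
  - (d1 + d3 + d5) * (d2 + d4 + d6) * (d1 - d5) * (d2 - d6) * (d3 - d4).

Definition coef_f : K :=
  - (d1 + d2 + d4) * (d3 + d5 + d6) * (d1 - d4) * (d2 - d5) * (d3 - d6).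

Definition coef_g : K :=
  - (d1 + d3 + d4) * (d2 + d5 + d6) * (d1 - d4) * (d2 - d6) * (d3 - d5).

Definition coef_h : K :=
  - (d1 + d2 + d5) * (d3 + d4 + d6) * (d1 - d5) * (d3 - d6) * (d2 - d4).

Definition octanomial : {mpoly K[4]} :=
  let x := 'X_0 in let y := 'X_1 in let z := 'X_2 in let w := 'X_3 in
  coef_a *: (x * y * z) + coef_b *: (x * y * w)
  + coef_c *: (x * z * w) + coef_d *: (y * z * w)
  + coef_e *: (x ^+ 2 * y) + coef_f *: (x * y ^+ 2)
  + coef_g *: (z ^+ 2 * w) + coef_h *: (z * w ^+ 2).

(* Main.v *)
Require Import Defs.
From HB Require Import structures.
From mathcomp Require Import all_boot all_order all_algebra.
From mathcomp Require Import mpoly ring.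

(** Write the octanomial as f = xy * l + zw * m with the linear forms
    l = ex + f0 y + az + bw and m = cx + dy + gz + hw, where f0 is the
    coefficient of x y^2.

    f vanishes on the image.  Substituting the four cubics, l becomes
    - k * F35 F24 F16 and m becomes k * F34 F25 F16 for one scalar k, so xy * l
    and zw * m become opposite multiples of the product of the same nine lines
    (lemmas [cubics_l], [cubics_m] and [octa_val_cubics]).

    f generates the ideal.  Let G vanish on the image.  In the coordinates
    al = x / z and be = y / w, one has f = z * w * (z * T + w * R) with
      R = f0 al be^2 + b al be + d be + h, T = e al^2 be + a al be + c al + g,
    so the surface is parametrized by (al R : - be T : R : - T), see
    [octa_param].  A general parameter comes from a point of the plane:
    prescribing al = F34 F56 / (F35 F46) and be = F25 F46 / (F24 F56) means
    intersecting two conics that share the points 4, 5 and 6, and their fourth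
    intersection point is found by solving a linear system
    ([point_of_pencils]).  Hence G vanishes at the parametrized points for
    general parameters, so for all of them ([octa_param_vanish]), and
    therefore at all points of f = 0 with z * w * R <> 0.

    Divide G by f with respect to x: y ^ N * G = Q * f + A * x + B, where A and
    B involve only y, z, w ([octa_pseudo_division]).  For general (y, z, w) the
    quadratic polynomial f in x has two distinct roots, both giving points at
    which G vanishes ([octa_two_points]); so A and B vanish at (y, z, w), and
    A = B = 0.  As y does not divide f, it can be cancelled, and f divides G
    ([octa_dvd]).

    Finally, the zero locus of f is the closure of the image, because every form
    vanishing on the image is a multiple of f. *)

Set Implicit Arguments.
Unset Strict Implicit.
Unset Printing Implicit Defensive.

Import GRing.Theory Num.Theory.
Local Open Scope ring_scope.

(** * Multivariate polynomials *)

Lemma mpoly_ring_ind (n : nat) (R : comNzRingType) (P : {mpoly R[n]} -> Prop) :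
  (forall c, P c%:MP) -> (forall p q, P p -> P q -> P (p + q)) ->
  (forall i p, P p -> P ('X_i * p)) -> forall p, P p.
Proof.
move=> PC PD PX; elim/mpolyind => [|c m p _ _ Pp]; first by rewrite -mpolyC0.
apply: PD => //; rewrite -mul_mpolyC mulrC.
suff: forall p, P p -> P ('X_[m] * p) by apply.
rewrite mpolyXE_id; apply: (big_ind (fun t => forall p, P p -> P (t * p))).
- by move=> q; rewrite mul1r.
- by move=> s t Ps Pt q Pq; rewrite -mulrA; apply/Ps/Pt.
move=> i _; elim: (m i) => [|k IH] q Pq; first by rewrite expr0 mul1r.
by rewrite exprS -mulrA; apply/PX/IH.
Qed.

Lemma meval_muni (n : nat) (R : comNzRingType) (p : {mpoly R[n.+1]})
    (v : 'I_n.+1 -> R) :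
  p.@[v] =
  (map_poly (meval (fun i : 'I_n => v (widen_ord (leqnSn n) i))) (muni p)).[
    v ord_max].
Proof.
rewrite mevalE muniE !raddf_sum horner_sum; apply: eq_bigr => m _ /=.
rewrite big_ord_recr map_polyZ hornerZ /= map_polyXn hornerXn mevalZ mevalX.
rewrite mulrA.
by congr (_ * _ * _); apply: eq_bigr => i _; rewrite mnmE.
Qed.

Lemma muni_eq0 (n : nat) (R : comNzRingType) (p : {mpoly R[n.+1]}) :
  muni p = 0 -> p = 0.
Proof.
move=> p0; suff -> : p = (map_poly (@mwiden n R) (muni p)).['X_ord_max].
  by rewrite p0 map_poly0 horner0.
rewrite {1}[p]mpolyE muniE !raddf_sum horner_sum; apply: eq_bigr => m _ /=.
rewrite map_polyZ hornerZ /= map_polyXn hornerXn mwidenZ mwidenX -scalerAl.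
congr (_ *: _); rewrite mpolyXn -mpolyXD; congr 'X_[_]; apply/mnmP => i.
rewrite mnmDE mulmnE mnm1E; have [j ->|->] := unliftP ord_max i.
  have -> : lift ord_max j = widen_ord (leqnSn n) j.
    by apply: val_inj; rewrite /= /bump leqNgt ltn_ord.
  rewrite mnmwiden_widen mnmE [_ == _](_ : _ = false) ?addn0 //.
  by rewrite -val_eqE /= gtn_eqF.
by rewrite mnmwiden_ordmax eqxx mul1n.
Qed.

(** An algebraically closed field is infinite: a nonzero polynomial in one
    variable has a non-root there, and the other variables are treated one at a
    time through [muni]. *)
Lemma mpoly_eq0_closed (n : nat) (L : closedFieldType) (p : {mpoly L[n]}) :
  (forall v, p.@[v] = 0) -> p = 0.
Proof.
elim: n => [|n IH] in p * => p0.
  have E : forall q : {mpoly L[0]}, q = (q.@[fun=> 0])%:MP.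
    elim/mpoly_ring_ind => [c|q r {1}-> {1}->|[]//]; first by rewrite mevalC.
    by rewrite mevalD mpolyCD.
  by rewrite (E p) p0 mpolyC0.
apply/muni_eq0/polyP => k; rewrite coef0; apply: IH => v.
suff /polyP/(_ k) : map_poly (meval v) (muni p) = 0 by rewrite coef_map coef0.
apply/eqP/negbNE/negP => /closed_nonrootP [t /rootP]; apply.
pose u (i : 'I_n.+1) := oapp v t (unlift ord_max i).
rewrite -(p0 u) meval_muni /u unlift_none; congr (_.[_]).
apply: eq_map_poly => q; apply: meval_eq => i /=.
have -> : widen_ord (leqnSn n) i = lift ord_max i.
  by apply: val_inj; rewrite /= /bump leqNgt ltn_ord.
by rewrite liftK.
Qed.

(** An identity checked at the points of a nonempty open set holds everywhere;
    this is how every general-position argument below is closed. *)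
Lemma mpoly_eq0_generic (n : nat) (L : closedFieldType) (p q : {mpoly L[n]}) :
  q != 0 -> (forall v, q.@[v] != 0 -> p.@[v] = 0) -> p = 0.
Proof.
move=> q0 pq; have /eqP : p * q = 0.
  apply: mpoly_eq0_closed => v; rewrite mevalM.
  by have [->|/pq ->] := eqVneq q.@[v] 0; rewrite ?mulr0 ?mul0r.
by rewrite mulf_eq0 (negPf q0) orbF => /eqP.
Qed.

Lemma mpoly_neq0 (n : nat) (R : comNzRingType) (p : {mpoly R[n]}) v :
  p.@[v] != 0 -> p != 0.
Proof. by apply: contraNneq => ->; rewrite meval0. Qed.

Lemma meval_map_mpoly (n : nat) (k l : comNzRingType) (f : {rmorphism k -> l})
    (p : {mpoly k[n]}) v :
  (map_mpoly f p).@[f \o v] = f p.@[v].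
Proof.
elim/mpoly_ring_ind: p => [c|p q Ep Eq|i p Ep].
- by rewrite map_mpolyC !mevalC.
- by rewrite rmorphD !mevalD Ep Eq rmorphD.
by rewrite rmorphM /= map_mpolyX !mevalM !mevalXU Ep rmorphM.
Qed.

Lemma map_mpoly_eq0 (n : nat) (k l : fieldType) (f : {rmorphism k -> l})
    (p : {mpoly k[n]}) :
  (map_mpoly f p == 0) = (p == 0).
Proof.
apply/eqP/eqP => [p0|->]; last exact: raddf0.
apply/mpolyP => m; apply/eqP; rewrite mcoeff0 -(fmorph_eq0 f).
by rewrite -mcoeff_map_mpoly p0 mcoeff0.
Qed.

Definition erase_var (n : nat) (R : nzRingType) (i : 'I_n) (p : {mpoly R[n]}) :
    {mpoly R[n]} :=
  p \mPo [tuple if j == i then 0 else 'X_j | j < n].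

HB.instance Definition _ (n : nat) (R : comNzRingType) (i : 'I_n) :=
  GRing.RMorphism.copy (@erase_var n R i)
    (comp_mpoly [tuple if j == i then 0 else 'X_j | j < n]).

Lemma erase_varX (n : nat) (R : nzRingType) (i j : 'I_n) :
  erase_var i 'X_j = if j == i then 0 else 'X_j :> {mpoly R[n]}.
Proof. by rewrite /erase_var comp_mpolyXU -tnth_nth tnth_mktuple. Qed.

Lemma erase_varC (n : nat) (R : nzRingType) (i : 'I_n) (c : R) :
  erase_var i c%:MP = c%:MP.
Proof. exact: comp_mpolyC. Qed.

Lemma erase_varZ (n : nat) (R : nzRingType) (i : 'I_n) (c : R) p :
  erase_var i (c *: p) = c *: erase_var i p.
Proof. exact: comp_mpolyZ. Qed.

Lemma meval_erase_var (n : nat) (R : comNzRingType) (i : 'I_n)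
    (p : {mpoly R[n]}) v :
  (erase_var i p).@[v] = p.@[fun j => if j == i then 0 else v j].
Proof.
rewrite /erase_var comp_mpoly_meval; apply: meval_eq => j.
by rewrite tnth_mktuple; case: eqP; rewrite ?meval0 ?mevalXU.
Qed.

Lemma map_erase_var (n : nat) (k l : comNzRingType) (f : {rmorphism k -> l})
    (i : 'I_n) (p : {mpoly k[n]}) :
  map_mpoly f (erase_var i p) = erase_var i (map_mpoly f p).
Proof.
elim/mpoly_ring_ind: p => [c|p q Ep Eq|j p Ep].
- by rewrite erase_varC !map_mpolyC erase_varC.
- by rewrite !rmorphD /= Ep Eq.
rewrite !rmorphM /= Ep map_mpolyX !erase_varX.
by case: eqP; rewrite ?rmorph0 ?map_mpolyX.
Qed.

(** Division by the variable, with the value at 0 as remainder. *)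
Lemma erase_varK (n : nat) (R : comNzRingType) (i : 'I_n) (p : {mpoly R[n]}) :
  exists q, p = erase_var i p + 'X_i * q.
Proof.
elim/mpoly_ring_ind: p => [c|p p' [q Eq] [q' Eq']|j p [q Eq]].
- by exists 0; rewrite erase_varC mulr0 addr0.
- exists (q + q'); rewrite rmorphD mulrDr {1}Eq {1}Eq' /=; ring.
rewrite rmorphM /= erase_varX; have [->|_] := eqVneq j i.
  by exists p; rewrite mul0r add0r.
by exists ('X_j * q); rewrite {1}Eq; ring.
Qed.

(** A variable is a prime element: if it does not divide f, any power of it can
    be cancelled from a multiple of f. *)
Lemma cancel_var (n : nat) (k : fieldType) (i : 'I_n) N (f G Q : {mpoly k[n]}) :
  erase_var i f != 0 -> 'X_i ^+ N * G = Q * f -> exists H, G = H * f.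
Proof.
move=> f0; elim: N Q => [|N IH] Q; first by rewrite mul1r; exists Q.
move=> E; have := congr1 (erase_var i) E.
rewrite exprS !rmorphM /= erase_varX eqxx !mul0r => /esym/eqP.
rewrite mulf_eq0 (negPf f0) orbF => /eqP Q0.
have [Q'] := erase_varK i Q; rewrite Q0 add0r => EQ.
have X0 : 'X_i != 0 :> {mpoly k[n]}.
  by apply: (@mpoly_neq0 _ _ _ (fun=> 1)); rewrite mevalXU oner_neq0.
by apply: (IH Q'); apply: (mulfI X0); rewrite !mulrA -exprS E EQ.
Qed.

Lemma mevalXn (n : nat) (R : comNzRingType) (p : {mpoly R[n]}) v m :
  (p ^+ m).@[v] = p.@[v] ^+ m.
Proof. exact: rmorphXn. Qed.

(* Powers come first, lest they be unfolded into products. *)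
Definition meval_simp :=
  (mevalXn, mevalD, mevalN, mevalZ, mevalM, mevalXU, mevalC).

Lemma map_mpolyD (n : nat) (k l : nzRingType) (phi : {rmorphism k -> l})
    (p q : {mpoly k[n]}) :
  map_mpoly phi (p + q) = map_mpoly phi p + map_mpoly phi q.
Proof. exact: rmorphD. Qed.

Lemma map_mpolyN (n : nat) (k l : nzRingType) (phi : {rmorphism k -> l})
    (p : {mpoly k[n]}) :
  map_mpoly phi (- p) = - map_mpoly phi p.
Proof. exact: rmorphN. Qed.

Lemma map_mpolyM (n : nat) (k l : comNzRingType) (phi : {rmorphism k -> l})
    (p q : {mpoly k[n]}) :
  map_mpoly phi (p * q) = map_mpoly phi p * map_mpoly phi q.
Proof. exact: rmorphM. Qed.

Lemma map_mpolyXn (n : nat) (k l : comNzRingType) (phi : {rmorphism k -> l})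
    (p : {mpoly k[n]}) m :
  map_mpoly phi (p ^+ m) = map_mpoly phi p ^+ m.
Proof. exact: rmorphXn. Qed.

Definition map_mpoly_simp :=
  (map_mpolyXn, map_mpolyD, map_mpolyN, map_mpolyZ, map_mpolyM, map_mpolyX,
   map_mpolyC).

(** * Elementary linear and quadratic equations *)

Lemma quadratic_roots (L : closedFieldType) (p q r : L) :
  p != 0 -> q ^+ 2 - 4 * p * r != 0 ->
  exists x1 x2, [/\ x1 != x2, p * x1 ^+ 2 + q * x1 + r = 0
    & p * x2 ^+ 2 + q * x2 + r = 0].
Proof.
move=> p0 D0.
have [x Ex] := @solve_monicpoly L 2 (nth 0 [:: - r / p; - q / p]) isT.
rewrite !big_ord_recl big_ord0 /= in Ex.
have x_root : p * x ^+ 2 + q * x + r = 0 by rewrite Ex; field.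
exists x, (- q / p - x); split=> //; last by rewrite -[RHS]x_root; field.
have DE : q ^+ 2 - 4 * p * r = p ^+ 2 * (x - (- q / p - x)) ^+ 2.
  transitivity (q ^+ 2 - 4 * p * r + 4 * p * (p * x ^+ 2 + q * x + r)).
    by rewrite x_root; ring.
  by field.
by apply: contra_neq D0 => E; rewrite DE {1}E subrr expr0n mulr0.
Qed.

Lemma affine_two_zeros (k : fieldType) (p q x1 x2 : k) :
  x1 != x2 -> p * x1 + q = 0 -> p * x2 + q = 0 -> p = 0 /\ q = 0.
Proof.
move=> x12 E1 E2; have p0 : p = 0.
  apply/eqP; have /eqP : p * (x1 - x2) = 0.
    by rewrite -[RHS](subrr 0) -{1}E1 -E2; ring.
  by rewrite mulf_eq0 subr_eq0 (negPf x12) orbF.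
by split=> //; rewrite -E1 p0 mul0r add0r.
Qed.

Lemma linear_system3 (L : fieldType) (a1 b1 c1 a2 b2 c2 a3 b3 c3 : L) :
  a1 * (b2 * c3 - c2 * b3) - b1 * (a2 * c3 - c2 * a3)
    + c1 * (a2 * b3 - b2 * a3) = 0 ->
  exists X Y Z, [/\ [|| X != 0, Y != 0 | Z != 0],
    a1 * X + b1 * Y + c1 * Z = 0, a2 * X + b2 * Y + c2 * Z = 0
    & a3 * X + b3 * Y + c3 * Z = 0].
Proof.
move=> D0.
pose M : 'M[L]_3 := \matrix_(i, j) nth 0 (nth [::]
  [:: [:: a1; a2; a3]; [:: b1; b2; b3]; [:: c1; c2; c3]] i) j.
have : \det M == 0.
  rewrite (expand_det_row _ 0) !big_ord_recl big_ord0 /cofactor.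
  rewrite !(expand_det_row _ 0) !big_ord_recl !big_ord0 /cofactor !det_mx11.
  by rewrite !mxE /=; apply/eqP; rewrite -[RHS]D0 /bump /=; ring.
case/det0P => v v0 /matrixP vM; exists (v 0 0), (v 0 1), (v 0 2).
have i1 : lift ord0 ord0 = 1 :> 'I_3 by apply: val_inj.
have i2 : lift ord0 (lift ord0 ord0) = 2 :> 'I_3 by apply: val_inj.
split.
- apply: contraNT v0; rewrite !negb_or !negbK.
  move=> /and3P[/eqP X0 /eqP Y0 /eqP Z0].
  apply/eqP/rowP => -[[|[|[|//]]] i]; rewrite mxE.
  - by rewrite -[RHS]X0; congr (v _ _); apply: val_inj.
  - by rewrite -[RHS]Y0; congr (v _ _); apply: val_inj.
  - by rewrite -[RHS]Z0; congr (v _ _); apply: val_inj.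
- have := vM 0 0; rewrite !mxE !big_ord_recl big_ord0 !mxE /= i2 i1 => <-.
  ring.
- have := vM 0 1; rewrite !mxE !big_ord_recl big_ord0 !mxE /= i2 i1 => <-.
  ring.
- have := vM 0 2; rewrite !mxE !big_ord_recl big_ord0 !mxE /= i2 i1 => <-.
  ring.
Qed.

(** * Octanomial cubics *)

(** The eight coefficients, each field being named after its monomial. *)
Record coefs (R : Type) := Coefs {
  kxyz : R; kxyw : R; kxzw : R; kyzw : R;
  kxxy : R; kxyy : R; kzzw : R; kzww : R }.

Definition map_coefs (R S : Type) (phi : R -> S) (k : coefs R) : coefs S :=
  Coefs (phi (kxyz k)) (phi (kxyw k)) (phi (kxzw k)) (phi (kyzw k))
        (phi (kxxy k)) (phi (kxyy k)) (phi (kzzw k)) (phi (kzww k)).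

Definition octa (R : nzRingType) (k : coefs R) : {mpoly R[4]} :=
  let x := 'X_0 in let y := 'X_1 in let z := 'X_2 in let w := 'X_3 in
  kxyz k *: (x * y * z) + kxyw k *: (x * y * w)
  + kxzw k *: (x * z * w) + kyzw k *: (y * z * w)
  + kxxy k *: (x ^+ 2 * y) + kxyy k *: (x * y ^+ 2)
  + kzzw k *: (z ^+ 2 * w) + kzww k *: (z * w ^+ 2).

Definition octa_val (R : pzRingType) (k : coefs R) (x y z w : R) : R :=
  kxyz k * (x * y * z) + kxyw k * (x * y * w)
  + kxzw k * (x * z * w) + kyzw k * (y * z * w)
  + kxxy k * (x ^+ 2 * y) + kxyy k * (x * y ^+ 2)
  + kzzw k * (z ^+ 2 * w) + kzww k * (z * w ^+ 2).

Definition coords4 (R : Type) (x y z w : R) (i : 'I_4) : R :=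
  nth x [:: x; y; z; w] i.

Lemma meval_octa (R : comNzRingType) (k : coefs R) v :
  (octa k).@[v] = octa_val k (v 0) (v 1) (v 2) (v 3).
Proof. by rewrite /octa !meval_simp. Qed.

Lemma map_octa (R S : comNzRingType) (phi : {rmorphism R -> S}) (k : coefs R) :
  map_mpoly phi (octa k) = octa (map_coefs phi k).
Proof.
by rewrite /octa !expr2 !rmorphD /= !map_mpolyZ !rmorphM /= !map_mpolyX.
Qed.

Lemma octa_homog (R : nzRingType) (k : coefs R) : octa k \is 3.-homog.
Proof.
have X1 (i : 'I_4) : ('X_i : {mpoly R[4]}) \is 1.-homog.
  by rewrite dhomogX; apply/eqP/mdeg1.
have X3 (i j l : 'I_4) : ('X_i * 'X_j * 'X_l : {mpoly R[4]}) \is 3.-homog.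
  exact: (dhomogM (dhomogM (X1 i) (X1 j)) (X1 l)).
by rewrite /octa !expr2 !mulrA; do !apply: rpredD; apply: rpredZ; apply: X3.
Qed.

(** As a polynomial in x, f is e y x^2 + U x + V; multiplying by y lowers the
    degree in x of any polynomial modulo f until it is at most 1. *)
Lemma octa_pseudo_division (R : fieldType) (k : coefs R) (G : {mpoly R[4]}) :
  kxxy k != 0 ->
  exists N Q A B,
    'X_1 ^+ N * G = Q * octa k + erase_var 0 A * 'X_0 + erase_var 0 B.
Proof.
case: k => a b c d e f g h /= e_neq0; set P := octa _.
pose U : {mpoly R[4]} := a *: ('X_1 * 'X_2) + b *: ('X_1 * 'X_3)
  + c *: ('X_2 * 'X_3) + f *: 'X_1 ^+ 2.
pose V : {mpoly R[4]} := d *: ('X_1 * 'X_2 * 'X_3) + g *: ('X_2 ^+ 2 * 'X_3)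
  + h *: ('X_2 * 'X_3 ^+ 2).
have eU : erase_var 0 U = U.
  by rewrite /U !rmorphD /= !erase_varZ !expr2 !rmorphM /= !erase_varX.
have eV : erase_var 0 V = V.
  by rewrite /V !rmorphD /= !erase_varZ !expr2 !rmorphM /= !erase_varX.
have X2 : 'X_1 * 'X_0 ^+ 2 = e^-1 *: (P - U * 'X_0 - V) :> {mpoly R[4]}.
  apply: (canRL (scalerK e_neq0)).
  by rewrite /P /octa /U /V -!mul_mpolyC /=; ring.
elim/mpoly_ring_ind: G => [c0|p q|i p].
- exists 0, 0, 0, c0%:MP; rewrite rmorph0 /= !erase_varC expr0; ring.
- move=> [N [Q [A [B E]]]] [N' [Q' [A' [B' E']]]].
  exists (N + N'), ('X_1 ^+ N' * Q + 'X_1 ^+ N * Q'),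
    ('X_1 ^+ N' * A + 'X_1 ^+ N * A'), ('X_1 ^+ N' * B + 'X_1 ^+ N * B').
  rewrite !rmorphD !rmorphM !rmorphXn /= !erase_varX /=.
  transitivity ('X_1 ^+ N' * ('X_1 ^+ N * p) + 'X_1 ^+ N * ('X_1 ^+ N' * q)).
    by rewrite exprD; ring.
  by rewrite E E'; ring.
move=> [N [Q [A [B E]]]]; have [->|i0] := eqVneq i 0.
  exists N.+1, ('X_0 * 'X_1 * Q + e^-1 *: erase_var 0 A),
    (- e^-1 *: (A * U) + 'X_1 * B), (- e^-1 *: (A * V)).
  rewrite !rmorphD /= !erase_varZ !rmorphM /= eU eV !erase_varX /=.
  transitivity ('X_0 * 'X_1 * ('X_1 ^+ N * p)); first by rewrite exprS; ring.
  rewrite E; transitivity ('X_0 * 'X_1 * Q * P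
      + erase_var 0 A * ('X_1 * 'X_0 ^+ 2) + 'X_1 * erase_var 0 B * 'X_0).
    by ring.
  by rewrite X2 -!mul_mpolyC rmorphN; ring.
exists N, ('X_i * Q), ('X_i * A), ('X_i * B).
by rewrite mulrCA E !rmorphM /= erase_varX (negPf i0); ring.
Qed.

(** The summand z w^2 R of f = z^2 w T + z w^2 R.  Where it vanishes
    on the surface, so does T, and (al, be) do not determine the point. *)
Definition ruling_val (R : pzRingType) (k : coefs R) (x y z w : R) : R :=
  x * y * (kxyy k * y + kxyw k * w) + z * w * (kyzw k * y + kzww k * w).

(** Discriminant of f as a quadratic polynomial in x. *)
Definition octa_disc (R : pzRingType) (k : coefs R) (y z w : R) : R :=
  (kxyz k * (y * z) + kxyw k * (y * w) + kxzw k * (z * w)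
   + kxyy k * y ^+ 2) ^+ 2
  - 4 * kxxy k * (y * (kyzw k * (y * z * w) + kzzw k * (z ^+ 2 * w)
                       + kzww k * (z * w ^+ 2))).

(** Up to a monomial in y, z, w, the resultant with respect to x of f and
    [ruling_val]. *)
Definition octa_res (R : pzRingType) (k : coefs R) (y w : R) : R :=
  kxxy k * (w * (kyzw k * y + kzww k * w) ^+ 2)
  - (kyzw k * y + kzww k * w) * (kxyy k * y + kxyw k * w)
    * (kxyz k * y + kxzw k * w)
  + kzzw k * (y * (kxyy k * y + kxyw k * w) ^+ 2).

Lemma octa_two_points (L : closedFieldType) (k : coefs L) (y z w : L) :
  kxxy k != 0 -> y != 0 -> z != 0 -> w != 0 ->
  octa_disc k y z w != 0 -> octa_res k y w != 0 ->
  exists x1 x2, x1 != x2 /\ forall x, x \in [:: x1; x2] ->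
    octa_val k x y z w = 0 /\ ruling_val k x y z w != 0.
Proof.
case: k => a b c d e f g h /= e0 y0 z0 w0; set k := Coefs _ _ _ _ _ _ _ _.
move=> disc0 res0; have ey0 : e * y != 0 by rewrite mulf_neq0.
pose q := a * (y * z) + b * (y * w) + c * (z * w) + f * y ^+ 2.
pose r := d * (y * z * w) + g * (z ^+ 2 * w) + h * (z * w ^+ 2).
have [|x1 [x2 [x12 r1 r2]]] := @quadratic_roots _ _ q r ey0.
  by apply: contra_neq disc0 => E; rewrite -E /octa_disc /= -/q -/r; ring.
exists x1, x2; split=> // x x_in.
have Ex : octa_val k x y z w = 0.
  transitivity (e * y * x ^+ 2 + q * x + r).
    by rewrite /octa_val /q /r /=; ring.
  by move: x_in; rewrite !inE => /orP[] /eqP ->.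
split=> //; apply/negP => /eqP R0.
pose T := x * y * (e * x + a * z) + z * w * (c * x + g * z).
have T0 : T = 0.
  by rewrite -[RHS]Ex -[LHS]addr0 -R0 /T /octa_val /ruling_val /=; ring.
(* Elimination of x between T = 0 and x * kk + z * w * hh = 0. *)
suff : z ^+ 2 * w * y * octa_res k y w = 0.
  by apply/eqP; rewrite !mulf_neq0 ?expf_neq0.
pose kk := y * (f * y + b * w); pose hh := d * y + h * w.
have xk : x * kk = - (z * w * hh).
  apply/eqP; rewrite -addr_eq0 -R0 /ruling_val /kk /hh /=.
  by apply/eqP; ring.
transitivity (e * y * (- (z * w * hh)) ^+ 2
  + (a * (y * z) + c * (z * w)) * kk * (- (z * w * hh))
  + g * (z ^+ 2 * w * kk ^+ 2)).
  by rewrite /octa_res /kk /hh /=; ring.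
rewrite -xk; transitivity (kk ^+ 2 * T); first by rewrite /T; ring.
by rewrite T0 mulr0.
Qed.

(** Besides e, the leading coefficient in the division by f, the nonvanishing
    hypotheses concern the values at (0 : 0 : 1 : 1) of the discriminant c^2, of
    the resultant h (e h - b c) and of f itself, g + h. *)
Lemma octa_dvd (K0 : fieldType) (L : closedFieldType)
    (phi : {rmorphism K0 -> L}) (k : coefs K0) (G : {mpoly K0[4]}) :
  kxxy k != 0 -> kzww k != 0 -> kxzw k != 0 ->
  kxxy k * kzww k - kxyw k * kxzw k != 0 -> kzzw k + kzww k != 0 ->
  (forall x y z w : L, z != 0 -> w != 0 ->
     ruling_val (map_coefs phi k) x y z w != 0 ->
     octa_val (map_coefs phi k) x y z w = 0 ->
     (map_mpoly phi G).@[coords4 x y z w] = 0) ->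
  exists H, G = H * octa k.
Proof.
move=> e0 h0 c0 eh0 gh0 GP.
have [N [Q [A [B E]]]] := octa_pseudo_division G e0.
suff [A0 B0] : erase_var 0 A = 0 /\ erase_var 0 B = 0.
  apply: (@cancel_var _ _ 1 N _ _ Q); last first.
    by rewrite E A0 B0 mul0r !addr0.
  apply: (@mpoly_neq0 _ _ _ (coords4 0 0 1 1)).
  rewrite meval_erase_var meval_octa /octa_val /coords4 /=.
  by apply: contra_neq gh0 => <-; ring.
move: e0 h0 c0 eh0 gh0 GP E.
case: k => a b c d e f g h /= e0 h0 c0 eh0 gh0 GP E.
pose disc : {mpoly K0[4]} :=
  (a *: ('X_1 * 'X_2) + b *: ('X_1 * 'X_3) + c *: ('X_2 * 'X_3)
   + f *: 'X_1 ^+ 2) ^+ 2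
  - (4 * e) *: ('X_1 * (d *: ('X_1 * 'X_2 * 'X_3) + g *: ('X_2 ^+ 2 * 'X_3)
                        + h *: ('X_2 * 'X_3 ^+ 2))).
pose eH : {mpoly K0[4]} := d *: 'X_1 + h *: 'X_3.
pose eK : {mpoly K0[4]} := f *: 'X_1 + b *: 'X_3.
pose res : {mpoly K0[4]} :=
  e *: ('X_3 * eH ^+ 2) - eH * eK * (a *: 'X_1 + c *: 'X_3)
  + g *: ('X_1 * eK ^+ 2).
have X0 i : 'X_i != 0 :> {mpoly K0[4]}.
  by apply: (@mpoly_neq0 _ _ _ (fun=> 1)); rewrite mevalXU oner_neq0.
have disc0 : disc != 0.
  apply: (@mpoly_neq0 _ _ _ (coords4 0 0 1 1)).
  rewrite /disc !meval_simp /coords4 /=.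
  by apply: contra_neq (expf_neq0 2 c0) => <-; ring.
have res0 : res != 0.
  apply: (@mpoly_neq0 _ _ _ (coords4 0 0 1 1)).
  rewrite /res /eH /eK !meval_simp /coords4 /=.
  by apply: contra_neq (mulf_neq0 h0 eh0) => <-; ring.
pose D := 'X_1 * 'X_2 * 'X_3 * disc * res.
have D0 : map_mpoly phi D != 0.
  rewrite map_mpoly_eq0.
  exact: mulf_neq0 (mulf_neq0 (mulf_neq0 (mulf_neq0 (X0 1) (X0 2)) (X0 3))
    disc0) res0.
suff gen v : (map_mpoly phi D).@[v] != 0 ->
    (map_mpoly phi (erase_var 0 A)).@[v] = 0 /\
    (map_mpoly phi (erase_var 0 B)).@[v] = 0.
  split; apply/eqP; rewrite -(map_mpoly_eq0 phi); apply/eqP.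
    by apply: (mpoly_eq0_generic D0) => v /gen[].
  by apply: (mpoly_eq0_generic D0) => v /gen[].
rewrite /D /disc /res /eH /eK !map_mpoly_simp !meval_simp.
rewrite !(rmorphM phi) rmorph_nat.
pose y := v 1; pose z := v 2; pose w := v 3; rewrite -/y -/z -/w.
rewrite !mulf_eq0 !negb_or -!andbA => /and5P[y0 z0 w0 dv rv].
have Fe0 : phi e != 0 by rewrite fmorph_eq0.
have [x1 [x2 [x12 xP]]] := @octa_two_points _
  (map_coefs phi (Coefs a b c d e f g h)) y z w Fe0 y0 z0 w0 dv rv.
have AB x : x \in [:: x1; x2] ->
    (map_mpoly phi (erase_var 0 A)).@[v] * x
    + (map_mpoly phi (erase_var 0 B)).@[v] = 0.
  move=> /xP [Px Rx].
  have eraseE p : (map_mpoly phi (erase_var 0 p)).@[v] =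
      (map_mpoly phi (erase_var 0 p)).@[coords4 x y z w].
    rewrite !map_erase_var !meval_erase_var; apply: meval_eq => i.
    by case: i => [[|[|[|[|[]]]]] i4] //=; congr v; apply: val_inj.
  (* The divisor is made opaque so that rewriting does not expand it. *)
  have [P' [E' P'0]] : exists P',
      'X_1 ^+ N * G = Q * P' + erase_var 0 A * 'X_0 + erase_var 0 B
      /\ (map_mpoly phi P').@[coords4 x y z w] = 0.
    by exists (octa (Coefs a b c d e f g h)); rewrite map_octa meval_octa.
  have := congr1 (fun p => (map_mpoly phi p).@[coords4 x y z w]) E'.
  rewrite !map_mpolyD !map_mpolyM map_mpolyXn !map_mpolyX.
  rewrite !mevalD !mevalM mevalXn !mevalXU (GP x y z w) // P'0.
  by rewrite !mulr0 add0r -!eraseE => /esym.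
by apply: (affine_two_zeros x12); apply: AB; rewrite !inE eqxx ?orbT.
Qed.

(** The coordinates (z, w) = (s R, - s T) of the point
    (al * z : be * w : z : w) of the surface. *)
Definition octa_param (R : pzRingType) (k : coefs R) (al be s : R) : R * R :=
  (s * (kxyy k * (al * be ^+ 2) + kxyw k * (al * be) + kyzw k * be + kzww k),
   - (s * (kxxy k * (al ^+ 2 * be) + kxyz k * (al * be) + kxzw k * al
           + kzzw k))).

Lemma octa_param_onto (L : fieldType) (k : coefs L) (x y z w : L) :
  z != 0 -> w != 0 -> ruling_val k x y z w != 0 -> octa_val k x y z w = 0 ->
  octa_param k (x / z) (y / w) (z ^+ 2 * w ^+ 2 / ruling_val k x y z w)
  = (z, w).
Proof.
move=> z0 w0 R0 f0; set r := ruling_val k x y z w in R0 *.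
rewrite /octa_param; congr pair.
  transitivity (z * (ruling_val k x y z w / r)); last by rewrite divff ?mulr1.
  by rewrite /ruling_val; field; rewrite z0 w0 R0.
transitivity (- (w * ((octa_val k x y z w - ruling_val k x y z w) / r))).
  by rewrite /octa_val /ruling_val; field; rewrite z0 w0 R0.
by rewrite f0 sub0r mulNr divff // mulrN mulr1 opprK.
Qed.

(** * Six points on the cuspidal cubic *)

Definition line_val (R : pzRingType) (s t X Y Z : R) : R :=
  s * t * (s + t) * X - (s ^+ 2 + s * t + t ^+ 2) * Y + Z.

(** The six points are pairwise distinct and no three of them are collinear. *)
Definition general_position (R : pzRingType) (d : nat -> R) :=
  (forall i j, (0 < i < j)%N -> (j <= 6)%N -> d i - d j != 0) /\
  (forall i j l, (0 < i < j)%N -> (j < l <= 6)%N -> d i + d j + d l != 0).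

(** Value at (1 : k : k ^ 3) of the line through the points s and t. *)
Definition line_at_point (R : pzRingType) (k s t : R) : R :=
  (k - s) * (k - t) * (k + s + t).

Lemma line_val_point (R : comPzRingType) (k s t X : R) :
  line_val s t X (k * X) (k ^+ 3 * X) = line_at_point k s t * X.
Proof. by rewrite /line_val /line_at_point; ring. Qed.

Lemma line_valC (R : comPzRingType) (s t X Y Z : R) :
  line_val s t X Y Z = line_val t s X Y Z.
Proof. by rewrite /line_val; ring. Qed.

Lemma lines_meet (L : fieldType) (i j k X Y Z : L) :
  i - j != 0 -> i + j + k != 0 ->
  line_val i k X Y Z = 0 -> line_val j k X Y Z = 0 ->
  Y = k * X /\ Z = k ^+ 3 * X.
Proof.
move=> ij0 ijk0 Ei Ej; have EY : Y = k * X.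
  apply/eqP; rewrite -subr_eq0 -oppr_eq0 opprB; apply/eqP.
  apply: (mulfI (mulf_neq0 ij0 ijk0)); rewrite mulr0 -(subrr 0) -{1}Ei -Ej.
  by rewrite /line_val; ring.
split=> //; apply/eqP; rewrite -subr_eq0 -Ei EY /line_val; apply/eqP; ring.
Qed.

(** Determinant of the coefficients of three lines. *)
Definition lines_det (R : pzRingType) (s t u v p q : R) : R :=
  let A x y := x * y * (x + y) in let B x y := - (x ^+ 2 + x * y + y ^+ 2) in
  A s t * (B u v - B p q) - B s t * (A u v - A p q)
  + (A u v * B p q - B u v * A p q).

(** Coefficients of mu and mu ^ 2 in the determinant of the three lines
    F46 - mu F56, al mu F35 - F34 and be F24 - mu F25.  There are no other
    terms, because F46, F34, F24 meet in the point 4 and F56, F35, F25 in the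
    point 5. *)
Definition pencil0 (R : pzRingType) (d : nat -> R) (al be : R) : R :=
  al * be * lines_det (d 4) (d 6) (d 3) (d 5) (d 2) (d 4)
  + lines_det (d 4) (d 6) (d 3) (d 4) (d 2) (d 5)
  + be * lines_det (d 5) (d 6) (d 3) (d 4) (d 2) (d 4).

Definition pencil1 (R : pzRingType) (d : nat -> R) (al be : R) : R :=
  - (al * lines_det (d 4) (d 6) (d 3) (d 5) (d 2) (d 5)
     + al * be * lines_det (d 5) (d 6) (d 3) (d 5) (d 2) (d 4)
     + lines_det (d 5) (d 6) (d 3) (d 4) (d 2) (d 5)).

(** The parameters for which the point found in [point_of_pencils] could be the
    point 6, 3, 2 or 1 of the plane, respectively, are excluded. *)
Definition avoids (R : pzRingType) (d : nat -> R) (al be : R) :=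
  [/\ al * be * (line_at_point (d 6) (d 3) (d 5)
                 * line_at_point (d 6) (d 2) (d 4))
      - line_at_point (d 6) (d 3) (d 4) * line_at_point (d 6) (d 2) (d 5) != 0,
     be * (line_at_point (d 3) (d 2) (d 4) * line_at_point (d 3) (d 5) (d 6))
      - line_at_point (d 3) (d 2) (d 5) * line_at_point (d 3) (d 4) (d 6) != 0,
     al * (line_at_point (d 2) (d 3) (d 5) * line_at_point (d 2) (d 4) (d 6))
      - line_at_point (d 2) (d 3) (d 4) * line_at_point (d 2) (d 5) (d 6) != 0
   & al * (line_at_point (d 1) (d 3) (d 5) * line_at_point (d 1) (d 4) (d 6))
      - line_at_point (d 1) (d 3) (d 4) * line_at_point (d 1) (d 5) (d 6) != 0].

(** The two conics al F35 F46 = F34 F56 and be F24 F56 = F25 F46 meet in the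
    points 4, 5, 6 and in one more point.  With mu = F46 / F56 their equations
    become linear, and the system is solvable exactly when mu is 0, infinite or
    - pencil0 / pencil1; the first two values give the points 4 and 5. *)
Lemma point_of_pencils (L : fieldType) (d : nat -> L) (al be : L) :
  general_position d -> pencil0 d al be != 0 -> pencil1 d al be != 0 ->
  avoids d al be ->
  exists X Y Z, let F i j := line_val (d i) (d j) X Y Z in
  [/\ [|| X != 0, Y != 0 | Z != 0],
      al * (F 3 5 * F 4 6) = F 3 4 * F 5 6,
      be * (F 2 4 * F 5 6) = F 2 5 * F 4 6
    & [&& F 3 5 != 0, F 4 6 != 0, F 2 4 != 0, F 5 6 != 0
        & (F 1 2 != 0) || (F 1 3 != 0)]].
Proof.
move=> [dB dS] p0 p1 [av6 av3 av2 av1].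
have d45 : d 4 - d 5 != 0 by apply: dB.
have d23 : d 2 - d 3 != 0 by apply: dB.
have d456 : d 4 + d 5 + d 6 != 0 by apply: dS.
have d453 : d 4 + d 5 + d 3 != 0 by rewrite addrC addrA; apply: dS.
have d452 : d 4 + d 5 + d 2 != 0 by rewrite addrC addrA; apply: dS.
have d231 : d 2 + d 3 + d 1 != 0 by rewrite addrC addrA; apply: dS.
pose mu := - pencil0 d al be / pencil1 d al be.
have mu0 : mu != 0 by apply: mulf_neq0; rewrite ?oppr_eq0 ?invr_eq0.
pose A i j := d i * d j * (d i + d j).
pose B i j := - (d i ^+ 2 + d i * d j + d j ^+ 2).
have [|X [Y [Z [P0 E1 E2 E3]]]] := @linear_system3 L
    (A 4 6 - mu * A 5 6) (B 4 6 - mu * B 5 6) (1 - mu)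
    (al * mu * A 3 5 - A 3 4) (al * mu * B 3 5 - B 3 4) (al * mu - 1)
    (be * A 2 4 - mu * A 2 5) (be * B 2 4 - mu * B 2 5) (be - mu).
  transitivity (mu * (pencil0 d al be + mu * pencil1 d al be)).
    by rewrite /A /B /pencil0 /pencil1 /lines_det; ring.
  by rewrite /mu divfK // addrN mulr0.
exists X, Y, Z => F.
have {E1} E1 : F 4 6 = mu * F 5 6.
  by apply/eqP; rewrite -subr_eq0 -E1 /F /A /B /line_val; apply/eqP; ring.
have {E2} E2 : F 3 4 = al * mu * F 3 5.
  apply/esym/eqP; rewrite -subr_eq0 -E2 /F /A /B /line_val; apply/eqP; ring.
have {E3} E3 : be * F 2 4 = mu * F 2 5.
  by apply/eqP; rewrite -subr_eq0 -E3 /F /A /B /line_val; apply/eqP; ring.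
have al_eq : al * (F 3 5 * F 4 6) = F 3 4 * F 5 6 by rewrite E1 E2; ring.
have be_eq : be * (F 2 4 * F 5 6) = F 2 5 * F 4 6 by rewrite mulrA E3 E1; ring.
have not_at k p q : Y = d k * X -> Z = d k ^+ 3 * X -> p - q != 0 ->
    p * X * X = q * X * X -> False.
  move=> EY EZ pq0 /eqP; have X0 : X != 0.
    move: P0; rewrite EY EZ !mulf_eq0 !negb_or.
    by case/or3P => // /andP[].
  by rewrite -subr_eq0 -!mulrBl !mulf_eq0 (negPf pq0) (negPf X0).
have Fk k i j : Y = d k * X -> Z = d k ^+ 3 * X ->
    F i j = line_at_point (d k) (d i) (d j) * X.
  by move=> EY EZ; rewrite /F EY EZ line_val_point.
have F56 : F 5 6 != 0.
  apply/eqP => F0; have F46 : F 4 6 = 0 by rewrite E1 F0 mulr0.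
  have [EY EZ] := lines_meet d45 d456 F46 F0.
  apply: (not_at 6 _ _ EY EZ av6); have F6 i j := Fk 6 i j EY EZ.
  transitivity (al * F 3 5 * (be * F 2 4)); first by rewrite !F6; ring.
  transitivity (F 3 4 * F 2 5); last by rewrite !F6; ring.
  by rewrite E2 E3; ring.
have F46 : F 4 6 != 0 by rewrite E1 mulf_neq0.
have F35 : F 3 5 != 0.
  apply/eqP => F0; have F34 : F 3 4 = 0 by rewrite E2 F0 mulr0.
  have [EY EZ] := lines_meet d45 d453 (etrans (line_valC _ _ _ _ _) F34)
    (etrans (line_valC _ _ _ _ _) F0).
  apply: (not_at 3 _ _ EY EZ av3); have F3 i j := Fk 3 i j EY EZ.
  transitivity (be * (F 2 4 * F 5 6)); first by rewrite !F3; ring.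
  by rewrite be_eq !F3; ring.
have F24 : F 2 4 != 0.
  apply/eqP => F0; have F25 : F 2 5 = 0.
    by apply: (mulfI mu0); rewrite -E3 F0 !mulr0.
  have [EY EZ] := lines_meet d45 d452 (etrans (line_valC _ _ _ _ _) F0)
    (etrans (line_valC _ _ _ _ _) F25).
  apply: (not_at 2 _ _ EY EZ av2); have F2 i j := Fk 2 i j EY EZ.
  transitivity (al * (F 3 5 * F 4 6)); first by rewrite !F2; ring.
  by rewrite al_eq !F2; ring.
split=> //; rewrite F56 F46 F35 F24 /= -negb_and.
apply/andP => -[/eqP F12 /eqP F13].
have [EY EZ] := lines_meet d23 d231 (etrans (line_valC _ _ _ _ _) F12)
  (etrans (line_valC _ _ _ _ _) F13).
apply: (not_at 1 _ _ EY EZ av1); have F1 i j := Fk 1 i j EY EZ.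
transitivity (al * (F 3 5 * F 4 6)); first by rewrite !F1; ring.
by rewrite al_eq !F1; ring.
Qed.

(** * The four cubics and their octanomial *)

(** Common shape of the coefficients a, b, c, d. *)
Definition mixed_coef (R : pzRingType) (s t u v p q : R) : R :=
  s * t * u * v * (s + t - u - v) + u * v * p * q * (u + v - p - q)
  + p * q * s * t * (p + q - s - t)
  + p * q * (p + q) * (s ^+ 2 + t ^+ 2 - u ^+ 2 - v ^+ 2)
  + s * t * (s + t) * (u ^+ 2 + v ^+ 2 - p ^+ 2 - q ^+ 2)
  + u * v * (u + v) * (p ^+ 2 + q ^+ 2 - s ^+ 2 - t ^+ 2).

(** Common shape of the coefficients e, f, g, h. *)
Definition square_coef (R : pzRingType) (s t u v p q : R) : R :=
  - (s + t + u) * (v + p + q) * (s - u) * (v - q) * (t - p).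

Definition six_coefs (R : pzRingType) (d : nat -> R) : coefs R :=
  Coefs (mixed_coef (d 1) (d 3) (d 2) (d 4) (d 5) (d 6))
        (mixed_coef (d 1) (d 2) (d 3) (d 5) (d 4) (d 6))
        (mixed_coef (d 1) (d 3) (d 2) (d 5) (d 4) (d 6))
        (mixed_coef (d 1) (d 2) (d 3) (d 4) (d 5) (d 6))
        (square_coef (d 1) (d 3) (d 5) (d 2) (d 4) (d 6))
        (square_coef (d 1) (d 2) (d 4) (d 3) (d 5) (d 6))
        (square_coef (d 1) (d 3) (d 4) (d 2) (d 5) (d 6))
        (square_coef (d 1) (d 2) (d 5) (d 3) (d 4) (d 6)).

Lemma map_six_coefs (R S : comPzRingType) (phi : {rmorphism R -> S})
    (d : nat -> R) :
  map_coefs phi (six_coefs d) = six_coefs (phi \o d).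
Proof.
have mixedE s t u v p q : phi (mixed_coef s t u v p q) =
    mixed_coef (phi s) (phi t) (phi u) (phi v) (phi p) (phi q).
  by rewrite /mixed_coef; ring.
have squareE s t u v p q : phi (square_coef s t u v p q) =
    square_coef (phi s) (phi t) (phi u) (phi v) (phi p) (phi q).
  by rewrite /square_coef; ring.
by rewrite /map_coefs /six_coefs /= !mixedE !squareE.
Qed.

Section Cubics.

Variables (R : comPzRingType) (d : nat -> R) (X Y Z : R).
Let F i j := line_val (d i) (d j) X Y Z.
Let k := six_coefs d.

Definition cubic_x := F 1 2 * F 3 4 * F 5 6.
Definition cubic_y := F 1 3 * F 2 5 * F 4 6.
Definition cubic_z := F 1 2 * F 3 5 * F 4 6.
Definition cubic_w := F 1 3 * F 2 4 * F 5 6.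

Definition tritangent_scalar :=
  (d 1 - d 6) * (d 2 - d 3) * (d 4 - d 5) * (d 1 + d 2 + d 3)
  * (d 4 + d 5 + d 6).

(** The planes l = 0 and m = 0 are tritangent planes of the surface, so their
    sections pull back to triples of lines through pairs of points. *)
Lemma cubics_l :
  kxxy k * cubic_x + kxyy k * cubic_y + kxyz k * cubic_z + kxyw k * cubic_w
  = - tritangent_scalar * (F 3 5 * F 2 4 * F 1 6).
Proof.
rewrite /k /= /cubic_x /cubic_y /cubic_z /cubic_w /tritangent_scalar.
by rewrite /F /line_val /mixed_coef /square_coef; ring.
Qed.

Lemma cubics_m :
  kxzw k * cubic_x + kyzw k * cubic_y + kzzw k * cubic_z + kzww k * cubic_w
  = tritangent_scalar * (F 3 4 * F 2 5 * F 1 6).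
Proof.
rewrite /k /= /cubic_x /cubic_y /cubic_z /cubic_w /tritangent_scalar.
by rewrite /F /line_val /mixed_coef /square_coef; ring.
Qed.

Lemma octa_val_cubics : octa_val k cubic_x cubic_y cubic_z cubic_w = 0.
Proof.
transitivity
  (cubic_x * cubic_y
     * (kxxy k * cubic_x + kxyy k * cubic_y + kxyz k * cubic_z
        + kxyw k * cubic_w)
   + cubic_z * cubic_w
     * (kxzw k * cubic_x + kyzw k * cubic_y + kzzw k * cubic_z
        + kzww k * cubic_w)).
  by rewrite /octa_val; ring.
by rewrite cubics_l cubics_m /cubic_x /cubic_y /cubic_z /cubic_w; ring.
Qed.

End Cubics.

(** The point of the plane comes from [point_of_pencils], which gives the ratios
    x / z and y / w.  The ratio z / w is then right as well, because
    al * be * l + m = 0 at that point: this relation, obtained from the factored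
    forms of l and m, is z * T + w * R = 0. *)
Lemma octa_param_in_image (L : fieldType) (d : nat -> L) (al be s : L) :
  let zw := octa_param (six_coefs d) al be s in
  general_position d -> pencil0 d al be != 0 -> pencil1 d al be != 0 ->
  avoids d al be -> zw.1 != 0 ->
  exists X Y Z t,
  [/\ [|| X != 0, Y != 0 | Z != 0], t != 0, cubic_z d X Y Z != 0
    & [/\ al * zw.1 = t * cubic_x d X Y Z, be * zw.2 = t * cubic_y d X Y Z,
          zw.1 = t * cubic_z d X Y Z & zw.2 = t * cubic_w d X Y Z]].
Proof.
move=> zw gp p0 p1 av r0.
have [X [Y [Z [P0 al_eq be_eq]]]] := point_of_pencils gp p0 p1 av.
case/and5P=> F35 F46 F24 F56 F1.
pose F i j := line_val (d i) (d j) X Y Z.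
have l_eq := cubics_l d X Y Z; have m_eq := cubics_m d X Y Z.
have x_eq : cubic_x d X Y Z = al * cubic_z d X Y Z.
  by rewrite /cubic_x -mulrA -al_eq /cubic_z; ring.
have y_eq : cubic_y d X Y Z = be * cubic_w d X Y Z.
  by rewrite /cubic_y -mulrA -be_eq /cubic_w; ring.
have zw_neq0 : (cubic_z d X Y Z != 0) || (cubic_w d X Y Z != 0).
  by case/orP: F1 => F1; apply/orP; [left|right]; rewrite !mulf_neq0.
have albe : al * be * (F 3 5 * F 2 4) = F 3 4 * F 2 5.
  apply: (mulfI (mulf_neq0 F46 F56)).
  transitivity (al * (F 3 5 * F 4 6) * (be * (F 2 4 * F 5 6))).
    by rewrite /F; ring.
  by rewrite al_eq be_eq /F; ring.
have zwE : cubic_w d X Y Z * zw.1 = cubic_z d X Y Z * zw.2.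
  apply/eqP; rewrite -subr_eq0; apply/eqP.
  transitivity (s * (al * be
      * (- tritangent_scalar d * (F 3 5 * F 2 4 * F 1 6))
      + tritangent_scalar d * (F 3 4 * F 2 5 * F 1 6))).
    by rewrite -l_eq -m_eq x_eq y_eq /zw /octa_param; cbn [fst snd]; ring.
  by rewrite -albe; ring.
have z0 : cubic_z d X Y Z != 0.
  apply/negP => /eqP z0; move: zw_neq0; rewrite z0 eqxx /=.
  apply/negP/negPn; have /eqP := zwE; rewrite z0 mul0r mulf_eq0.
  by rewrite (negPf r0) orbF.
exists X, Y, Z, (zw.1 / cubic_z d X Y Z); split=> //.
  by rewrite mulf_neq0 ?invr_eq0.
have w_eq : zw.2 = zw.1 / cubic_z d X Y Z * cubic_w d X Y Z.
  by apply: (mulfI z0); rewrite -zwE; field.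
by split=> //; rewrite ?x_eq ?y_eq ?w_eq; field.
Qed.

(** All the conditions on the parameters hold at al = be = 0, s = 1, hence for
    general parameters. *)
Lemma octa_param_vanish (L : closedFieldType) (d : nat -> L)
    (G : {mpoly L[4]}) :
  general_position d ->
  (forall X Y Z t, [|| X != 0, Y != 0 | Z != 0] -> t != 0 ->
     cubic_z d X Y Z != 0 ->
     G.@[coords4 (t * cubic_x d X Y Z) (t * cubic_y d X Y Z)
                 (t * cubic_z d X Y Z) (t * cubic_w d X Y Z)] = 0) ->
  forall al be s, let zw := octa_param (six_coefs d) al be s in
  G.@[coords4 (al * zw.1) (be * zw.2) zw.1 zw.2] = 0.
Proof.
move=> gp G0 al be s; have [dB dS] := gp.
have nB i j : (i != j)%N -> (0 < i <= 6)%N -> (0 < j <= 6)%N -> d i - d j != 0.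
  rewrite neq_ltn => /orP[] ij /andP[i0 i6] /andP[j0 j6].
    by apply: dB; rewrite ?i0.
  by rewrite -opprB oppr_eq0; apply: dB; rewrite ?j0.
have lap i j l : [&& 0 < i <= 6, 0 < j, j < l, l <= 6, i != j & i != l]%N ->
    line_at_point (d i) (d j) (d l) != 0.
  case/and5P=> /andP[i0 i6] j0 jl l6 /andP[ij il].
  have [l0 j6] : (0 < l /\ j <= 6)%N.
    by split; [apply: ltn_trans j0 jl | apply: leq_trans (ltnW jl) l6].
  rewrite !mulf_neq0 ?nB ?i0 ?j0 ?l0 //.
  move: ij il; rewrite !neq_ltn => /orP[] ij /orP[] il.
  - by apply: dS; rewrite ?i0 ?jl.
  - by have := ltn_trans jl il; rewrite ltnNge ltnW.
  - by rewrite [d i + _]addrC; apply: dS; rewrite ?j0 ?il.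
  - by rewrite -addrA addrC; apply: dS; rewrite ?j0 ?il.
have h0 : kzww (six_coefs d) != 0.
  by rewrite /= /square_coef !mulf_neq0 ?oppr_eq0 ?dS ?nB.
have p00 : lines_det (d 4) (d 6) (d 3) (d 4) (d 2) (d 5) != 0.
  have -> : lines_det (d 4) (d 6) (d 3) (d 4) (d 2) (d 5) =
      (d 3 - d 6) * (d 3 + d 4 + d 6) * line_at_point (d 4) (d 2) (d 5).
    by rewrite /lines_det /line_at_point; ring.
  by rewrite mulf_neq0 ?lap // mulf_neq0 ?nB ?dS.
have p10 : lines_det (d 5) (d 6) (d 3) (d 4) (d 2) (d 5) != 0.
  have -> : lines_det (d 5) (d 6) (d 3) (d 4) (d 2) (d 5) =
      (d 6 - d 2) * (d 2 + d 5 + d 6) * line_at_point (d 5) (d 3) (d 4).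
    by rewrite /lines_det /line_at_point; ring.
  by rewrite mulf_neq0 ?lap // mulf_neq0 ?nB ?dS.
have lap2 i j l m n : line_at_point (d i) (d j) (d l) != 0 ->
    line_at_point (d i) (d m) (d n) != 0 ->
    - (line_at_point (d i) (d j) (d l) * line_at_point (d i) (d m) (d n)) != 0.
  by move=> *; rewrite oppr_eq0 mulf_neq0.
have q6 := lap2 6 3 4 2 5 (lap 6 3 4 isT) (lap 6 2 5 isT).
have q3 := lap2 3 2 5 4 6 (lap 3 2 5 isT) (lap 3 4 6 isT).
have q2 := lap2 2 3 4 5 6 (lap 2 3 4 isT) (lap 2 5 6 isT).
have q1 := lap2 1 3 4 5 6 (lap 1 3 4 isT) (lap 1 5 6 isT).
move=> zw.
(* All the conditions except R <> 0 are nonvanishing of such a polynomial, and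
   they hold at al = be = 0 as soon as c00 <> 0. *)
pose bil c11 c10 c01 c00 : {mpoly L[3]} :=
  c11 *: ('X_0 * 'X_1) + c10 *: 'X_0 + c01 *: 'X_1 + c00%:MP.
pose pt al be s : 'I_3 -> L := fun i => nth 0 [:: al; be; s] i.
have ptE al' be' s' : (pt al' be' s' 0 = al') * (pt al' be' s' 1 = be')
    * (pt al' be' s' 2 = s') by [].
have bil0 c11 c10 c01 c00 : c00 != 0 -> bil c11 c10 c01 c00 != 0.
  move=> c0; apply: (@mpoly_neq0 _ _ _ (pt 0 0 0)).
  by apply: contra_neq c0 => <-; rewrite /bil !meval_simp /pt /=; ring.
have bilE al' be' s' c11 c10 c01 c00 :
    (bil c11 c10 c01 c00).@[pt al' be' s'] =
    c11 * (al' * be') + c10 * al' + c01 * be' + c00.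
  by rewrite /bil !meval_simp.
pose k := six_coefs d.
pose R1 : {mpoly L[3]} :=
  'X_2 * (kxyy k *: ('X_0 * 'X_1 ^+ 2) + bil (kxyw k) 0 (kyzw k) (kzww k)).
pose R2 : {mpoly L[3]} :=
  - ('X_2 * (kxxy k *: ('X_0 ^+ 2 * 'X_1) + bil (kxyz k) (kxzw k) 0 (kzzw k))).
pose E := G \mPo [tuple 'X_0 * R1; 'X_1 * R2; R1; R2].
pose D6 := bil
  (line_at_point (d 6) (d 3) (d 5) * line_at_point (d 6) (d 2) (d 4)) 0 0
  (- (line_at_point (d 6) (d 3) (d 4) * line_at_point (d 6) (d 2) (d 5))).
pose D3 := bil 0 0
  (line_at_point (d 3) (d 2) (d 4) * line_at_point (d 3) (d 5) (d 6))
  (- (line_at_point (d 3) (d 2) (d 5) * line_at_point (d 3) (d 4) (d 6))).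
pose D2 := bil 0
  (line_at_point (d 2) (d 3) (d 5) * line_at_point (d 2) (d 4) (d 6)) 0
  (- (line_at_point (d 2) (d 3) (d 4) * line_at_point (d 2) (d 5) (d 6))).
pose D1 := bil 0
  (line_at_point (d 1) (d 3) (d 5) * line_at_point (d 1) (d 4) (d 6)) 0
  (- (line_at_point (d 1) (d 3) (d 4) * line_at_point (d 1) (d 5) (d 6))).
pose C0 := bil (lines_det (d 4) (d 6) (d 3) (d 5) (d 2) (d 4)) 0
  (lines_det (d 5) (d 6) (d 3) (d 4) (d 2) (d 4))
  (lines_det (d 4) (d 6) (d 3) (d 4) (d 2) (d 5)).
pose C1 := bil (lines_det (d 5) (d 6) (d 3) (d 5) (d 2) (d 4))
  (lines_det (d 4) (d 6) (d 3) (d 5) (d 2) (d 5)) 0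
  (lines_det (d 5) (d 6) (d 3) (d 4) (d 2) (d 5)).
pose D := R1 * (C0 * C1) * (D6 * D3 * D2 * D1).
have R10 : R1 != 0.
  apply: (@mpoly_neq0 _ _ _ (pt 0 0 1)).
  apply: contra_neq h0 => <-; rewrite /R1 mevalM mevalD bilE !meval_simp.
  by rewrite !ptE -/k; ring.
have D0 : D != 0.
  exact: mulf_neq0
    (mulf_neq0 R10 (mulf_neq0 (bil0 _ _ _ _ p00) (bil0 _ _ _ _ p10)))
    (mulf_neq0 (mulf_neq0 (mulf_neq0 (bil0 _ _ _ _ q6) (bil0 _ _ _ _ q3))
      (bil0 _ _ _ _ q2)) (bil0 _ _ _ _ q1)).
have Eval v :
    E.@[v] = G.@[coords4 (v 0 * R1.@[v]) (v 1 * R2.@[v]) R1.@[v] R2.@[v]].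
  rewrite /E comp_mpoly_meval; apply: meval_eq.
  by case=> [[|[|[|[|[]]]]] i4] //=; rewrite mevalM mevalXU.
have RE al' be' s' : (R1.@[pt al' be' s'], R2.@[pt al' be' s']) =
    octa_param k al' be' s'.
  rewrite /octa_param; congr pair; rewrite /R1 /R2.
    by rewrite mevalM mevalD bilE !meval_simp !ptE; ring.
  by rewrite mevalN mevalM mevalD bilE !meval_simp !ptE; ring.
suff E0 : E = 0.
  by have := Eval (pt al be s); rewrite E0 meval0 /zw -RE => ->.
apply: (mpoly_eq0_generic D0) => v.
have vE p : p.@[v] = p.@[pt (v 0) (v 1) (v 2)].
  apply: meval_eq => -[[|[|[|[]]]] i3] //=; rewrite /pt /=; congr v;
    exact: val_inj.
rewrite !{}vE; move: (v 0) (v 1) (v 2) => al' be' s'.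
set u := pt al' be' s'.
have -> : D.@[u] = R1.@[u] * (C0.@[u] * C1.@[u])
    * (D6.@[u] * D3.@[u] * D2.@[u] * D1.@[u]) by rewrite -!mevalM.
rewrite /D6 /D3 /D2 /D1 /C0 /C1 !bilE mulf_eq0 negb_or.
case/andP=> /[!mulf_eq0] /[!negb_or] /and3P[r0 c00 c10].
case/andP=> /andP[/andP[e6 e3] e2] e1.
have [||||X [Y [Z [t [P0 t0 z0 [x_eq y_eq z_eq w_eq]]]]]] :=
  octa_param_in_image (al := al') (be := be') (s := s') gp.
- by apply: contra_neq c00; rewrite /pencil0 => c0; rewrite -[RHS]c0; ring.
- apply: contra_neq c10; rewrite /pencil1 => c0.
  by apply: oppr_inj; rewrite oppr0 -[RHS]c0; ring.
- by split; [apply: contra_neq e6|apply: contra_neq e3|apply: contra_neq e2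
    |apply: contra_neq e1] => c0; rewrite -[RHS]c0; ring.
- by rewrite -RE.
have := G0 X Y Z t P0 t0 z0.
by rewrite -x_eq -y_eq -z_eq -w_eq -RE Eval.
Qed.

(** * The generic six points *)

(** Polynomials in the indeterminates d_i are shown to be nonzero by evaluating
    them at d_i = i. *)
Definition spec_pt (i : 'I_6) : rat := (val i).+1%:R.

Definition var_ (i : nat) : {mpoly rat[6]} := 'X_(inord i.-1).

Lemma meval_var i : (0 < i <= 6)%N -> (var_ i).@[spec_pt] = i%:R.
Proof. by case: i => // i i6; rewrite mevalXU /spec_pt /= inordK. Qed.

Lemma tofrac_neq0 (p : {mpoly rat[6]}) :
  p.@[spec_pt] != 0 -> tofrac p != 0 :> K.
Proof. by move=> pv; rewrite tofrac_eq0; apply: mpoly_neq0 pv. Qed.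

Lemma d_general_position : general_position d_.
Proof.
split=> [i j /andP[i0 ij] j6|i j l /andP[i0 ij] /andP[jl l6]].
  have -> : d_ i - d_ j = tofrac (var_ i - var_ j) by rewrite rmorphB.
  apply: tofrac_neq0; rewrite mevalB !meval_var ?i0 ?(leq_trans (ltnW ij))
    ?(ltn_trans i0) //.
  by rewrite subr_eq0 eqr_nat ltn_eqF.
have j0 := ltn_trans i0 ij; have l0 := ltn_trans j0 jl.
have j6 := ltnW (leq_trans jl l6); have i6 := ltnW (leq_trans ij j6).
have -> : d_ i + d_ j + d_ l = tofrac (var_ i + var_ j + var_ l).
  by rewrite !rmorphD.
apply: tofrac_neq0; rewrite !mevalD !meval_var ?i0 ?j0 ?l0 //.
by rewrite -!natrD pnatr_eq0 -lt0n !addn_gt0 i0.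
Qed.

Lemma six_coefs_lift : exists k : coefs {mpoly rat[6]},
  six_coefs d_ = map_coefs (@tofrac _) k /\
  map_coefs (meval spec_pt) k = six_coefs (fun i => i%:R).
Proof.
exists (six_coefs var_); split; first by rewrite map_six_coefs.
by rewrite map_six_coefs /six_coefs /= !meval_var.
Qed.

Lemma coef_c_neq0 : kxzw (six_coefs d_) != 0.
Proof.
have [k [-> kE]] := six_coefs_lift.
have cE := congr1 (@kxzw _) kE; cbn [kxzw map_coefs six_coefs] in cE.
apply: tofrac_neq0; rewrite cE (_ : mixed_coef _ _ _ _ _ _ = - 2274%:R).
  by rewrite oppr_eq0 pnatr_eq0.
by rewrite /mixed_coef; ring.
Qed.

Lemma coef_eh_bc_neq0 : let k := six_coefs d_ in
  kxxy k * kzww k - kxyw k * kxzw k != 0.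
Proof.
have [k [-> kE]] := six_coefs_lift.
have bE := congr1 (@kxyw _) kE; have cE := congr1 (@kxzw _) kE.
have eE := congr1 (@kxxy _) kE; have hE := congr1 (@kzww _) kE.
cbn [kxyw kxzw kxxy kzww map_coefs six_coefs] in bE, cE, eE, hE |- *.
rewrite -!rmorphM -rmorphB; apply: tofrac_neq0; rewrite mevalB !mevalM.
rewrite bE cE eE hE (_ : _ - _ = - 148500%:R).
  by rewrite oppr_eq0 pnatr_eq0.
by rewrite /mixed_coef /square_coef; ring.
Qed.

Lemma coef_g_h_neq0 : let k := six_coefs d_ in kzzw k + kzww k != 0.
Proof.
have [k [-> kE]] := six_coefs_lift.
have gE := congr1 (@kzzw _) kE; have hE := congr1 (@kzww _) kE.
cbn [kzzw kzww map_coefs six_coefs] in gE, hE |- *.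
rewrite -rmorphD; apply: tofrac_neq0; rewrite mevalD.
rewrite gE hE (_ : _ + _ = 4992%:R); first by rewrite pnatr_eq0.
by rewrite /square_coef; ring.
Qed.

Lemma octanomialE : octanomial = octa (six_coefs d_).
Proof.
(* Only the last two factors of the coefficient f are in a different order. *)
have fE : coef_f = square_coef (d_ 1) (d_ 2) (d_ 4) (d_ 3) (d_ 5) (d_ 6).
  exact: mulrAC.
by rewrite /octanomial fE.
Qed.

Lemma octanomial_neq0 : octanomial != 0.
Proof.
apply: (@mpoly_neq0 _ _ _ (coords4 0 0 1 1)); rewrite octanomialE meval_octa.
rewrite /octa_val /coords4; cbn [nth nat_of_ord].
have := coef_g_h_neq0; move: (six_coefs d_) => k /= gh.
by apply: contra_neq gh => <-; ring.
Qed.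

Section Image.

Variables (L : closedFieldType) (iota : {rmorphism K -> L}).
Let d := iota \o d_.

Lemma iota_general_position : general_position d.
Proof.
have [dB dS] := d_general_position.
split=> [i j ij j6|i j l ij jl].
  by rewrite /d /= -(rmorphB iota) fmorph_eq0; apply: dB.
by rewrite /d /= -!(rmorphD iota) fmorph_eq0; apply: dS.
Qed.

Lemma vanishes_at_octanomial (q : 'rV[L]_4) :
  vanishes_at iota octanomial q <->
  octa_val (six_coefs d) (q 0 0) (q 0 1) (q 0 2) (q 0 3) = 0.
Proof.
by rewrite /vanishes_at octanomialE map_octa meval_octa map_six_coefs.
Qed.

Lemma eval_F i j (P : 'rV[L]_3) :
  (map_mpoly iota (F i j)).@[P 0] =
  line_val (d i) (d j) (P 0 0) (P 0 1) (P 0 2).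
Proof.
rewrite /F !map_mpoly_simp !meval_simp /line_val /d /=.
by rewrite !rmorphM !rmorphD !rmorphXn !rmorphM.
Qed.

Lemma eval_cubics (P : 'rV[L]_3) i :
  eval_forms iota cubics P 0 i =
  coords4
    (cubic_x d (P 0 0) (P 0 1) (P 0 2)) (cubic_y d (P 0 0) (P 0 1) (P 0 2))
    (cubic_z d (P 0 0) (P 0 1) (P 0 2)) (cubic_w d (P 0 0) (P 0 1) (P 0 2)) i.
Proof.
have F3 i1 j1 i2 j2 i3 j3 :
    (map_mpoly iota (F i1 j1 * F i2 j2 * F i3 j3)).@[P 0] =
    line_val (d i1) (d j1) (P 0 0) (P 0 1) (P 0 2)
    * line_val (d i2) (d j2) (P 0 0) (P 0 1) (P 0 2)
    * line_val (d i3) (d j3) (P 0 0) (P 0 1) (P 0 2).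
  rewrite map_mpolyM mevalM eval_F; congr (_ * _).
  by rewrite map_mpolyM mevalM !eval_F.
rewrite mxE (tnth_nth 0).
by case: i => [[|[|[|[|[]]]]] i4] //; apply: F3.
Qed.

Lemma octanomial_image q :
  rational_image iota cubics q -> vanishes_at iota octanomial q.
Proof.
move=> [P [t [_ _ _ ->]]]; apply/vanishes_at_octanomial.
have qE i : (t *: eval_forms iota cubics P) 0 i =
    t * eval_forms iota cubics P 0 i by rewrite mxE.
rewrite !qE !eval_cubics /coords4; cbn [nth nat_of_ord].
have := octa_val_cubics d (P 0 0) (P 0 1) (P 0 2).
move: (cubic_x _ _ _ _) (cubic_y _ _ _ _) (cubic_z _ _ _ _) (cubic_w _ _ _ _).
move: (six_coefs d) => k x y z w /= f0.
transitivity (t ^+ 3 * octa_val k x y z w); last by rewrite f0 mulr0.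
by rewrite /octa_val; ring.
Qed.

Lemma cubics_in_image X Y Z t :
  [|| X != 0, Y != 0 | Z != 0] -> t != 0 -> cubic_z d X Y Z != 0 ->
  rational_image iota cubics
    (\row_i coords4 (t * cubic_x d X Y Z) (t * cubic_y d X Y Z)
                    (t * cubic_z d X Y Z) (t * cubic_w d X Y Z) i).
Proof.
move=> P0 t0 z0; pose P : 'rV[L]_3 := \row_i nth 0 [:: X; Y; Z] i.
have PE : [/\ P 0 0 = X, P 0 1 = Y & P 0 2 = Z] by rewrite !mxE.
case: PE => PX PY PZ; exists P, t; split=> //.
- by apply: contraTneq P0 => P0; rewrite -PX -PY -PZ P0 !mxE eqxx.
- apply: contraNneq z0 => /rowP/(_ 2); rewrite eval_cubics PX PY PZ mxE.
  by move=> z0; apply/eqP.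
apply/rowP => i; rewrite [in RHS]mxE eval_cubics PX PY PZ mxE.
by case: i => [[|[|[|[|[]]]]] i4].
Qed.

Lemma octanomial_ideal (G : {mpoly K[4]}) :
  (forall q, rational_image iota cubics q -> vanishes_at iota G q) ->
  exists H, G = H * octanomial.
Proof.
move=> GP; have [dB dS] := d_general_position; rewrite octanomialE.
have e0 : kxxy (six_coefs d_) != 0.
  by rewrite /= /square_coef !mulf_neq0 ?oppr_eq0 ?dB ?dS.
have h0 : kzww (six_coefs d_) != 0.
  by rewrite /= /square_coef !mulf_neq0 ?oppr_eq0 ?dB ?dS.
apply: (octa_dvd (phi := iota) e0 h0 coef_c_neq0 coef_eh_bc_neq0 coef_g_h_neq0).
move=> x y z w z0 w0; rewrite map_six_coefs -/d => r0 f0.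
have := octa_param_vanish (G := map_mpoly iota G) iota_general_position.
move=> /(_ _ (x / z) (y / w)
  (z ^+ 2 * w ^+ 2 / ruling_val (six_coefs d) x y z w)).
rewrite octa_param_onto //= !divfK //; apply=> X Y Z t P0 t0 c0.
have := GP _ (cubics_in_image P0 t0 c0); rewrite /vanishes_at => <-.
by apply: meval_eq => i; rewrite mxE.
Qed.

End Image.

Theorem proposition2p1 (L : closedFieldType) (iota : {rmorphism K -> L}) :
  hypersurface_defined_by iota 3
    (zariski_closure iota (rational_image iota cubics)) octanomial.
Proof.
have f_homog : octanomial \is 3.-homog by rewrite octanomialE octa_homog.
split=> [||q|m G Ghom]; [exact: octanomial_neq0 | exact: f_homog | |].
  split=> -[q0 qP]; split=> //.
    exact: qP f_homog (@octanomial_image L iota).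
  move=> m G _ /octanomial_ideal [H ->].
  by move: qP; rewrite /vanishes_at rmorphM mevalM => ->; rewrite mulr0.
split=> [GP|[H ->] q [_ qP]].
  apply: (@octanomial_ideal L iota) => q qS; apply: GP; split=> [|l H _ HP].
    by case: qS => P [c [_ P0 c0 ->]]; rewrite scaler_eq0 negb_or c0.
  exact: HP.
have := qP _ _ f_homog (@octanomial_image L iota).
by rewrite /vanishes_at rmorphM mevalM => ->; rewrite mulr0.
Qed.
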